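(* Let $Q=T[H_1,\dots,H_t]$ be a strong semicomplete composition. If $T$ has a strict 3-king and every 2-king of $T$ is dominated by some strict 3-king of $T$, then $Q$ can be established, i.e. there exists a semicomplete composition $Q'$ containing $Q$ as an induced subdigraph such that the set of all 3-kings of $Q'$ is exactly $V(Q)$.
   Context: All digraphs are finite, without loops or parallel arcs; paths are directed; $d_D(x,y)$ is the length of a shortest directed $x$–$y$ path. Let $T$ be a digraph with vertices $u_1,\dots,u_t$ ($t\ge 2$) and $H_1,\dots,H_t$ digraphs, $H_i$ having vertices $u_{i,j}$, $1\le j\le n_i$. The composition $Q=T[H_1,\dots,H_t]$ has vertex set $\{u_{i,j}\}$ and arc set $\bigcup_i A(H_i)\cup\{u_{i,j}u_{p,q}: u_iu_p\in A(T)\}$ (all $j,q$). It is a semicomplete composition if $T$ is semicomplete (at least one arc between every two distinct vertices). A digraph is strong if every vertex can reach every other vertex. For $k\ge2$, a $k$-king of $D$ is a vertex from which every other vertex can be reached by a directed path of length at most $k$; a $k$-king $u$ is strict if there is a vertex $v$ with $d_D(u,v)=k$. A vertex $x$ dominates $y$ if $xy$ is an arc. *)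

(* Defs.v *)
From mathcomp Require Import all_boot.

Set Implicit Arguments.
Unset Strict Implicit.
Unset Printing Implicit Defensive.

Record digraph := Digraph {
  vertex :> finType;
  darc : rel vertex;
  darc_irr : irreflexive darc
}.

Section Digraphs.
Variable D : digraph.
Implicit Types (x y u v : D) (p : seq D) (k : nat).

(* The path is x :: p, so its length is size p. *)
Definition dipath x y p : bool :=
  [&& path (@darc D) x p, last x p == y & uniq (x :: p)].

Definition is_dist x y k : Prop :=
  (exists2 p, dipath x y p & size p = k) /\
  (forall p, dipath x y p -> k <= size p).

Definition strong : Prop := forall x y, connect (@darc D) x y.

Definition semicomplete : Prop := forall x y, x != y -> darc x y || darc y x.

Definition king k u : Prop :=
  forall v, v != u -> exists2 p, dipath u v p & size p <= k.

Definition strict_king k u : Prop := king k u /\ exists v, is_dist u v k.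

End Digraphs.

Section Composition.
Variables (T : digraph) (H : T -> digraph).

Definition comp_arc : rel {i : T & H i} := fun x y =>
  darc (tag x) (tag y) ||
  (tag x == tag y) && darc (tagged x) (tagged_as x y).

Lemma comp_arc_irr : irreflexive comp_arc.
Proof. by case=> i a; rewrite /comp_arc /= darc_irr eqxx tagged_asE darc_irr. Qed.

Definition composition : digraph := Digraph comp_arc_irr.

(* Digraphs are nonempty by convention, whereas a finType may be empty: hence
   the explicit condition on the components. *)
Definition semicomplete_composition : Prop :=
  [/\ 2 <= #|T|, forall i, 0 < #|H i| & semicomplete T].

End Composition.

Definition induced_embedding (D D' : digraph) (f : D -> D') : Prop :=
  injective f /\ forall x y, darc (f x) (f y) = darc x y.

Definition established (Q : digraph) : Prop :=
  exists (T' : digraph) (H' : T' -> digraph),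
    semicomplete_composition H' /\
    exists f : Q -> composition H',
      induced_embedding f /\
      forall x : composition H', king 3 x <-> exists y : Q, x = f y.

(* Main.v *)
Require Import Defs.
From mathcomp Require Import all_boot.

(** Let [K] be the set of 2-kings of [T].  For every vertex [a] outside [K] add
    a vertex [z a] whose only out-neighbour in [T] is [a] and which is dominated
    by all other vertices of [T].  Then every vertex of [T] reaches [a] by
    [u -> z a -> a], and reaches a 2-king [v] by [u -> z s -> s -> v], where [s]
    is a strict 3-king, hence outside [K], dominating [v].  On the other hand, a
    vertex [a] outside [K] is at distance at least 3 from some 2-king [w a], and
    [z a] does not reach [w a] in three steps provided that [z a -> z b] is
    avoided whenever [b -> w a].  This leaves an arc between any two new
    vertices: if both [b -> w a] and [a -> w b], then [w b], not being within
    distance 2 of [b], dominates the out-neighbour [w a] of [b], so that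
    [a -> w b -> w a] is a path of length 2. *)

Set Implicit Arguments.
Unset Strict Implicit.
Unset Printing Implicit Defensive.

(** * Reachability within two steps in semicomplete digraphs *)

Section Reachability.
Variable D : digraph.
Implicit Types (x y u v w : D) (p : seq D).

Lemma walk_dipath x p : path (@darc D) x p ->
  exists2 q, dipath x (last x p) q & size q <= size p.
Proof.
case/shortenP=> q xq Uq sub_qp; exists q; first by rewrite /dipath xq eqxx Uq.
by apply: uniq_leq_size sub_qp; case/andP: Uq.
Qed.

(* [g] bounds from below the distance to the zeros of [g]. *)
Lemma potential_path (g : D -> nat) x p :
  (forall u v, darc u v -> g u <= (g v).+1) ->
  path (@darc D) x p -> g x <= g (last x p) + size p.
Proof.
move=> g_arc; elim: p x => [|y p IHp] x /=; first by rewrite addn0.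
case/andP=> /g_arc le_xy /IHp le_y; rewrite addnS.
by apply: leq_trans le_xy _; rewrite ltnS.
Qed.

Definition reach2 x y :=
  [|| x == y, darc x y | [exists z, darc x z && darc z y]].

Lemma reach2_via x y z : darc x y -> darc y z -> reach2 x z.
Proof. by move=> xy yz; apply/or3P/Or33/existsP; exists y; rewrite xy. Qed.

Lemma reach2_dipath x y : reach2 x y -> exists2 p, dipath x y p & size p <= 2.
Proof.
have walk p : path (@darc D) x p -> size p <= 2 ->
    exists2 q, dipath x (last x p) q & size q <= 2.
  by case/walk_dipath=> q xq /leq_trans le_q /le_q; exists q.
case/or3P=> [/eqP<-|xy|/existsP[z /andP[xz zy]]].
- exact: (walk [::]).
- by apply: (walk [:: y]); rewrite /= ?xy.
- by apply: (walk [:: z; y]); rewrite /= ?xz ?zy.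
Qed.

(** Boolean, so that the vertices that are not 2-kings form a finite subtype. *)
Definition king2 u := [forall v, reach2 u v].

Lemma king2_king u : king2 u -> king 2 u.
Proof. by move/forallP=> uP v _; apply: reach2_dipath. Qed.

Lemma strict_king3_nking2 s : strict_king 3 s -> ~~ king2 s.
Proof.
case=> _ [v [_ min_v]]; apply/negP=> /forallP/(_ v)/reach2_dipath[p /min_v].
by case: (size p) => [|[|[|]]].
Qed.

Hypothesis semiD : semicomplete D.

Lemma semicomplete_nreach2 x y z : ~~ reach2 x z -> darc x y -> darc z y.
Proof.
move=> far_xz xy; have ne_zy : z != y.
  by apply: contraNneq far_xz => ->; rewrite /reach2 xy orbT.
case/orP: (semiD ne_zy) => // yz.
by rewrite (reach2_via xy yz) in far_xz.
Qed.

(** Let [k] maximize the out-degree inside [U]. A vertex of [U] beyond its two-step reach would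
    dominate [k] and all out-neighbours of [k] in [U], hence have a larger out-degree. *)
Lemma exists_king2_in (U : {set D}) u : u \in U ->
  exists2 k, k \in U & {in U, forall v, reach2 k v}.
Proof.
move=> Uu; pose out x := [set y in U | darc x y].
case: (@arg_maxnP _ u (mem U) (fun x => #|out x|) Uu) => k Uk max_k.
exists k => // v Uv; apply: contraT => far_kv.
have /orP vk : darc k v || darc v k.
  by apply: semiD; apply: contraNneq far_kv => ->; rewrite /reach2 eqxx.
have {}vk : darc v k.
  by case: vk => // kv; rewrite /reach2 kv orbT in far_kv.
have: out k \proper out v.
  apply/properP; split; last first.
    by exists k; rewrite !inE ?darc_irr ?andbF // vk andbT.
  apply/subsetP=> y; rewrite !inE => /andP[-> ky] /=.
  exact: semicomplete_nreach2 ky.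
by move/proper_card; rewrite ltnNge => /negP[]; apply: max_k.
Qed.

(** Take such a [k] for the set of vertices beyond the two-step reach of [a]. It dominates [a] and
    all out-neighbours of [a], so it also reaches in two steps whatever [a] does. *)
Lemma exists_far_king2 a : ~~ king2 a -> exists2 w, king2 w & ~~ reach2 a w.
Proof.
case/forallPn=> x far_x; pose U := [set v | ~~ reach2 a v].
have /exists_king2_in[k] : x \in U by rewrite inE.
rewrite inE => far_k kU; exists k => //; apply/forallP=> v.
have [|far_v] := boolP (reach2 a v); last by apply: kU; rewrite inE.
case/or3P=> [/eqP<-|av|/existsP[y /andP[ay yv]]]; last first.
- exact: reach2_via (semicomplete_nreach2 far_k ay) yv.
- by rewrite /reach2 (semicomplete_nreach2 far_k av) orbT.
have /semiD : k != a.
  by apply: contraNneq far_k => ->; rewrite /reach2 eqxx.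
case/orP=> [ka|ak]; first by rewrite /reach2 ka orbT.
by rewrite /reach2 ak orbT in far_k.
Qed.

(** In a semicomplete digraph the default [a] arises only when [a] is a 2-king. *)
Definition far_king2 a := odflt a [pick w | king2 w && ~~ reach2 a w].

Lemma far_king2P a :
  ~~ king2 a -> king2 (far_king2 a) /\ ~~ reach2 a (far_king2 a).
Proof.
move=> nk_a; rewrite /far_king2; case: pickP => [w /andP[]//|no_w].
by have [w kw far_w] := exists_far_king2 nk_a; have:= no_w w; rewrite kw far_w.
Qed.

End Reachability.

(** * Walks in a composition and their projections *)

Section CompositionPaths.
Variables (T : digraph) (H : T -> digraph).
Hypothesis H_gt0 : forall i, 0 < #|H i|.

Lemma comp_vertex i : {x : composition H | tag x = i}.
Proof. by have /card_gt0P/sigW[h _] := H_gt0 i; exists (Tagged (fun i => H i) h). Qed.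

(** On a path to the copy of [H b], the first arc that leaves the copy of [H a] projects to an arc
    of [T] out of [a]. *)
Lemma strong_composition_out (a b : T) :
  strong (composition H) -> a != b -> exists c, darc a c.
Proof.
move=> sQ; have [x <-] := comp_vertex a; have [y <-] := comp_vertex b.
case/connectP: (sQ x y) => p; elim: p x => [|z p IHp] x /=.
  by move=> _ ->; rewrite eqxx.
case/andP=> /orP[xz _ _ _|/andP[/eqP eq_xz _] zp y_last]; first by exists (tag z).
by rewrite eq_xz; apply: IHp.
Qed.

(* A closed walk of [T] through a vertex [i] joins any two vertices of the copy
   of [H i], whence the condition that the walk is not empty. *)
Lemma walk_comp_dipath (x y : composition H) p :
  path (@darc T) (tag x) (rcons p (tag y)) ->
  exists2 q, dipath x y q & size q <= (size p).+1.
Proof.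
move=> xpy; have [q xqy sq] : exists2 q,
    path (@darc (composition H)) x (rcons q y) & size q = size p.
  elim: p x xpy => [|i p IHp] x /=.
    by rewrite andbT => xy; exists [::] => //=; rewrite /comp_arc xy.
  have [z <-] := comp_vertex i; case/andP=> xz /IHp[q zqy sq].
  by exists (z :: q); rewrite /= ?sq // zqy andbT /comp_arc xz.
by have [r] := walk_dipath xqy; rewrite last_rcons size_rcons sq; exists r.
Qed.

Lemma potential_comp_path (g : T -> nat) (x : composition H) p :
  (forall i j, darc i j -> g i <= (g j).+1) ->
  path (@darc (composition H)) x p ->
  g (tag x) <= g (tag (last x p)) + size p.
Proof.
move=> g_arc; apply: (@potential_path (composition H) (fun z => g (tag z))) => u v.
by case/orP=> [/g_arc//|/andP[/eqP eq_uv _]]; rewrite eq_uv.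
Qed.

End CompositionPaths.

(** * The extended composition and its 3-kings *)

Section Extension.
Variables (T : digraph) (H : T -> digraph).

(** [inr a] is the new vertex [z a], and [far_king2 a] is [w a]. *)
Definition ext_vertex : finType := (T + {a : T | ~~ king2 a})%type.

Definition ext_arc : rel ext_vertex := fun i j =>
  match i, j with
  | inl x, inl y => darc x y
  | inl x, inr b => x != val b
  | inr a, inl y => y == val a
  | inr a, inr b => (a != b) && ~~ darc (val b) (far_king2 (val a))
  end.

Lemma ext_arc_irr : irreflexive ext_arc.
Proof. by case=> [x|a] /=; rewrite ?darc_irr ?eqxx. Qed.

Definition ext : digraph := Digraph ext_arc_irr.

Lemma point_arc_irr : irreflexive (fun _ _ : unit => false).
Proof. by []. Qed.

Definition ext_comp (i : ext) : digraph :=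
  match i with inl x => H x | inr _ => Digraph point_arc_irr end.

Definition ext_inj (x : composition H) : composition ext_comp :=
  Tagged (fun i : ext => ext_comp i) (i := inl (tag x)) (tagged x).

Lemma ext_inj_embedding : induced_embedding ext_inj.
Proof.
split=> [[i h] [j k]|[i h] [j k]].
  rewrite /ext_inj /= => eq_ij.
  have [eq_i] := congr1 tag eq_ij; case: j / eq_i k eq_ij => k.
  by move/eqP; rewrite eq_Tagged => /eqP/= ->.
rewrite /= /comp_arc /=; have [eq_ij|ne_ij] := eqVneq i j.
  by case: j / eq_ij k => k; rewrite eqxx !tagged_asE.
by case: eqP => [[/eqP]|//]; rewrite (negPf ne_ij).
Qed.

Hypothesis semiT : semicomplete T.

Lemma ext_semicomplete : semicomplete ext.
Proof.
case=> [x|a] [y|b] //= ne_ij.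
- exact: semiT.
- by rewrite orNb.
- by rewrite orbN.
have {}ne_ij : a != b by [].
rewrite ne_ij eq_sym ne_ij /= -negb_and; apply/negP=> /andP[b_wa a_wb].
have [_ far_b] := far_king2P semiT (valP b).
have [_ /negP[]] := far_king2P semiT (valP a).
exact: reach2_via a_wb (semicomplete_nreach2 semiT far_b b_wa).
Qed.

(** A lower bound for the distance to [w a]. Its values on [T] are capped at 3 because a detour
    through some [z b] can have that length; the value 4 at [z a] excludes a path of length 3. *)
Definition ext_potential (a : {a : T | ~~ king2 a}) (i : ext) : nat :=
  let w := far_king2 (val a) in
  match i with
  | inl x => if x == w then 0 else if darc x w then 1 else
             if reach2 x w then 2 else 3
  | inr b => if b == a then 4 else if darc (val b) w then 2 else 3
  end.

Lemma ext_potential_arc a (i j : ext) :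
  darc i j -> ext_potential a i <= (ext_potential a j).+1.
Proof.
have [kw far_a] := far_king2P semiT (valP a).
rewrite /ext_potential; set w := far_king2 _ in kw far_a *.
have a_w : (val a == w = false) * (darc (val a) w = false) * (reach2 (val a) w = false).
  split; last exact: negPf.
  by split; apply: contraNF far_a; rewrite /reach2 => ->; rewrite ?orbT.
case: i j => [x|b] [y|c] /=.
- move=> xy; have [_|_] := eqVneq x w; first by [].
  have [<-|_] := eqVneq y w; first by rewrite xy.
  case: ifP => // _; have [yw|_] := boolP (darc y w).
    by rewrite (reach2_via xy yw).
  by case: ifP => _; case: ifP.
- by move=> _; do ![case: ifP => _ //].
- move/eqP->; have [->|_] := eqVneq b a; first by rewrite !a_w.
  (* As [w] is a 2-king and [b] is not, no new vertex dominates [w]. *)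
  have [b_w|_] := eqVneq (val b) w; first by have:= valP b; rewrite b_w kw.
  by do ![case: ifP => _ //].
(* An arc from [z a] to [z c] requires that [c] does not dominate [w], so the potential of [z c] is
   3. *)
- case/andP; have [->|_ _] := eqVneq b a; last by do ![case: ifP => _ //].
  by rewrite eq_sym => /negPf-> /negPf->.
Qed.

Hypothesis H_gt0 : forall i, 0 < #|H i|.

Lemma ext_comp_gt0 i : 0 < #|ext_comp i|.
Proof. by case: i => [x|a]; [apply: H_gt0 | rewrite card_unit]. Qed.

Lemma ext_new_not_king3 (x : composition ext_comp) a :
  tag x = inr a -> ~ king 3 x.
Proof.
move=> def_x; have [y def_y] := comp_vertex ext_comp_gt0 (inl (far_king2 (val a))).
case/(_ y); first by apply: contra_eq_neq def_y => ->; rewrite def_x.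
move=> p /and3P[xp /eqP last_p _].
have := potential_comp_path (@ext_potential_arc a) xp.
by rewrite last_p def_x def_y /= !eqxx add0n ltnNge => /negP.
Qed.

Hypothesis outT : forall x : T, exists y, darc x y.
Hypothesis king2_dom : forall u : T, king2 u -> exists2 s, ~~ king2 s & darc s u.

(** The target [inl x] is included: the closed walk then obtained joins vertices of the same copy of
    [H x]. *)
Lemma ext_old_walk (x : T) (j : ext) : exists2 p,
  path (@darc ext) (inl x) (rcons p j) & size p <= 2.
Proof.
case: j => [y|b]; last first.
  have [x_b|ne_xb] := eqVneq x (val b); last by exists [::]; rewrite //= ne_xb.
  (* There is no arc from [b] to [z b], hence the passage through an out-neighbour. *)
  have [c xc] := outT x; exists [:: inl c] => //=.
  by rewrite xc -x_b andbT; apply: contraTneq xc => ->; rewrite darc_irr.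
have [/king2_dom[s nk_s sy]|nk_y] := boolP (king2 y).
  have [->|ne_xs] := eqVneq x s; first by exists [::]; rewrite //= sy.
  by exists [:: inr (Sub s nk_s); inl s]; rewrite //= ne_xs eqxx sy.
have [x_y|ne_xy] := eqVneq x y; last first.
  by exists [:: inr (Sub y nk_y)]; rewrite //= ne_xy eqxx.
(* The closed walk [x -> c -> z x -> x]. *)
have [c xc] := outT x; exists [:: inl c; inr (Sub y nk_y)] => //=.
rewrite xc eqxx -x_y !andbT.
by apply: contraTneq xc => ->; rewrite darc_irr.
Qed.

Lemma ext_old_king3 (x : composition H) : king 3 (ext_inj x).
Proof.
move=> y _; have [p xpy le_p] := ext_old_walk (tag x) (tag y).
have [q xqy le_q] := @walk_comp_dipath _ _ ext_comp_gt0 (ext_inj x) y p xpy.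
by exists q; rewrite // (leq_trans le_q).
Qed.

End Extension.

Theorem theorem2p10 (T : digraph) (H : T -> digraph) :
  semicomplete_composition H ->
  strong (composition H) ->
  (exists s : T, strict_king 3 s) ->
  (forall u : T, king 2 u -> exists2 s : T, strict_king 3 s & darc s u) ->
  established (composition H).
Proof.
case=> T_gt1 H_gt0 semiT strongQ _ domK.
have outT (x : T) : exists y, darc x y.
  have /card_gt0P[y] : 0 < #|[set~ x]| by rewrite cardsC1; case: #|T| T_gt1 => [|[]].
  by rewrite !inE eq_sym; apply: strong_composition_out H_gt0 _ _ strongQ.
have nking2_dom (u : T) : king2 u -> exists2 s, ~~ king2 s & darc s u.
  by move/king2_king/domK=> [s /strict_king3_nking2]; exists s.
exists (ext T), (ext_comp H); split.
  split; [|exact: ext_comp_gt0|exact: ext_semicomplete].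
  by rewrite card_sum (leq_trans T_gt1) ?leq_addr.
exists (@ext_inj T H); split=> [|x]; first exact: ext_inj_embedding.
split=> [king_x|[y ->]]; last exact: ext_old_king3.
case: x king_x => [[i|a] h] king_x; first by exists (Tagged (fun i => H i) h).
by case: (@ext_new_not_king3 T H semiT H_gt0 _ a _ king_x).
Qed.
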